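(* Let $\mathcal{H}$ be a real Hilbert space, let $Z$ be a nonempty closed convex subset of $\mathcal{H}$, let $(\lambda_n)_{n\in\mathbb{N}}$ be a sequence in $]0,1]$, and let $x_0\in\mathcal{H}$. Iterate: for every $n\in\mathbb{N}$, $H_n$ is a closed half-space of $\mathcal{H}$ such that $Z\subset H_n$, and $$p_n=\mathrm{proj}_{H_n}x_n,\qquad r_n=x_n+\lambda_n(p_n-x_n),\qquad x_{n+1}=\mathsf{Q}(x_0,x_n,r_n).$$ Then the sequence $(x_n)_{n\in\mathbb{N}}$ is well defined and the following hold: (i) $(\forall n\in\mathbb{N})$ $Z\subset H(x_0,x_n)\cap H(x_n,r_n)$. (ii) There exists $\ell\in[0,+\infty[$ such that $(\|x_n-x_0\|)_{n\in\mathbb{N}}$ is nondecreasing and converges to $\ell$, and $\ell\leq d_Z(x_0)$. (iii) $\sum_{n\in\mathbb{N}}\|x_{n+1}-x_n\|^2<+\infty$. (iv) $\sum_{n\in\mathbb{N}}\lambda_n^2\|p_n-x_n\|^2<+\infty$. (v) Suppose that every weak sequential cluster point of $(x_n)_{n\in\mathbb{N}}$ belongs to $Z$. Then $(x_n)_{n\in\mathbb{N}}$ converges strongly to $\mathrm{proj}_Zx_0$.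
   Context: $\mathrm{proj}_D$ denotes the projection operator onto a nonempty closed convex set $D\subset\mathcal{H}$, and $d_Z(x)=\inf_{z\in Z}\|x-z\|$. For $(x,y)\in\mathcal{H}^2$, $H(x,y)=\{z\in\mathcal{H}\mid\langle z-y\mid x-y\rangle\leq 0\}$ (so $H(x,x)=\mathcal{H}$). For $(x,y,z)\in\mathcal{H}^3$ such that $H(x,y)\cap H(y,z)\neq\varnothing$, $\mathsf{Q}(x,y,z)$ denotes the projection of $x$ onto $H(x,y)\cap H(y,z)$; ''well defined'' means that $H(x_0,x_n)\cap H(x_n,r_n)\neq\varnothing$ for every $n$. A weak sequential cluster point of a sequence is a weak limit of one of its subsequences. *)

(* Defs.v *)
From HB Require Import structures.
From mathcomp Require Import all_boot all_order all_algebra.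
From mathcomp Require Import all_classical all_reals all_analysis.
Set Implicit Arguments.
Unset Strict Implicit.
Unset Printing Implicit Defensive.
Import Order.TTheory GRing.Theory Num.Theory.
Import numFieldNormedType.Exports.

Local Open Scope classical_set_scope.
Local Open Scope ring_scope.

(* A real Hilbert space is a complete normed module H over a realType R with a
   positive definite symmetric bilinear form dot : {dot H for idfun} that
   induces its norm, i.e. satisfies norm_from_dot. *)
Definition norm_from_dot (R : realType) (H : completeNormedModType R)
    (dot : {dot H for idfun}) : Prop :=
  forall x : H, dot x x = `|x| ^+ 2.

Definition closed_halfspace (R : realType) (H : completeNormedModType R)
    (dot : {dot H for idfun}) (A : set H) : Prop :=
  exists u : H, exists eta : R, u != 0 /\ A = [set z | dot z u <= eta].

Definition is_proj (R : realType) (H : completeNormedModType R)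
    (D : set H) (x p : H) : Prop :=
  D p /\ forall y, D y -> `|x - p| <= `|x - y|.

(* The point of D nearest to x; it exists and is unique when D is nonempty,
   closed and convex.  When there is no nearest point (in particular when D is
   empty) the value is the default x. *)
Definition proj_on (R : realType) (H : completeNormedModType R)
    (D : set H) (x : H) : H :=
  xget x [set p | is_proj D x p].

Definition dist_to (R : realType) (H : completeNormedModType R)
    (Z : set H) (x : H) : R :=
  inf [set `|x - z| | z in Z].

Definition Hset (R : realType) (H : completeNormedModType R)
    (dot : {dot H for idfun}) (x y : H) : set H :=
  [set z | dot (z - y) (x - y) <= 0].

(* Meaningful only when the intersection is nonempty. *)
Definition Qproj (R : realType) (H : completeNormedModType R)
    (dot : {dot H for idfun}) (x y z : H) : H :=
  proj_on (Hset dot x y `&` Hset dot y z) x.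

Definition weak_cvg (R : realType) (H : completeNormedModType R)
    (dot : {dot H for idfun}) (x : nat -> H) (w : H) : Prop :=
  forall u : H, (fun n => dot (x n) u) @ \oo --> dot w u.

Definition weak_seq_cluster_point (R : realType) (H : completeNormedModType R)
    (dot : {dot H for idfun}) (x : nat -> H) (w : H) : Prop :=
  exists phi : nat -> nat,
    {homo phi : m n / (m < n)%N} /\ weak_cvg dot (x \o phi) w.

(* Main.v *)
(* The points of Z belong to every H(x_0, x_n) and H(x_n, r_n), by induction
   from the variational inequality of the projection.  Since x_(n+1) lies in both
   sets, the sequence ||x_n - x_0||^2 increases at step n by at least
   ||x_(n+1) - x_n||^2 >= ||r_n - x_n||^2, while it stays below d_Z(x_0)^2; this
   gives (i)-(iv) by telescoping.

   For (v), a subsequence staying away from q = proj_Z x_0 has a further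
   subsequence with a weak limit w, which lies in Z and satisfies
   ||x_0 - w|| <= ||x_0 - q||, so w = q; then ||x_n - q||^2 is at most
   2 <q - x_n | q - x_0>, which tends to 0 along it: contradiction.

   Weak sequential compactness is obtained without separability or Riesz
   representation: one extracts z_k such that <z_k | z_m> converges for every m,
   takes w in the closed convex hulls of all the tails, and checks that the u
   with <z_k | u> -> <w | u> form a closed subspace containing every z_m; a
   vector orthogonal to this subspace is orthogonal to all z_m and to w. *)
Require Import Defs.
From HB Require Import structures.
From mathcomp Require Import all_boot all_order all_algebra.
From mathcomp Require Import all_classical all_reals all_analysis.
From mathcomp Require Import ring lra.
Set Implicit Arguments.
Unset Strict Implicit.
Unset Printing Implicit Defensive.
Import Order.TTheory GRing.Theory Num.Theory.
Import numFieldNormedType.Exports.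

Local Open Scope classical_set_scope.
Local Open Scope ring_scope.

Section Hilbert.
Context (R : realType) (H : completeNormedModType R).
Context (dot : {dot H for idfun}) (dot_norm : norm_from_dot dot).
Implicit Types (u v w x y z : H) (D : set H).

(** * Inner product calculus and the Cauchy-Schwarz inequality *)

Lemma dotC u v : dot u v = dot v u.
Proof. by rewrite hermC /= expr0 mul1r. Qed.

Lemma dotDl u v w : dot (u + v) w = dot u w + dot v w.
Proof. by rewrite linearDl. Qed.
Lemma dotNl u v : dot (- u) v = - dot u v.
Proof. by rewrite linearNl. Qed.
Lemma dotZl a u v : dot (a *: u) v = a * dot u v.
Proof. by rewrite linearZl_LR. Qed.
Lemma dotDr u v w : dot u (v + w) = dot u v + dot u w.
Proof. by rewrite linearDr. Qed.
Lemma dotNr u v : dot u (- v) = - dot u v.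
Proof. by rewrite linearNr. Qed.
Lemma dotZr a u v : dot u (a *: v) = a * dot u v.
Proof. by rewrite linearZr_LR. Qed.

Definition dotE := (dotDl, dotDr, dotNl, dotNr, dotZl, dotZr).

Lemma normB_sqr u v : `|u - v| ^+ 2 = `|u| ^+ 2 - 2 * dot u v + `|v| ^+ 2.
Proof. rewrite -!dot_norm !dotE (dotC v u); lra. Qed.

(** The squared norm of |v|^2 u - <u|v> v equals |v|^2 (|u|^2 |v|^2 - <u|v>^2). *)
Lemma cauchy_schwarz u v : `|dot u v| <= `|u| * `|v|.
Proof.
have [->|v0] := eqVneq v 0.
  by rewrite linear0r normr0 mulr_ge0.
have nv : 0 < `|v| by rewrite normr_gt0.
rewrite -(@ler_pXn2r _ 2) ?nnegrE ?mulr_ge0// exprMn real_normK ?num_real//.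
have := sqr_ge0 `|(`|v| ^+ 2) *: u - dot u v *: v|.
rewrite -[X in 0 <= X]dot_norm !dotE (dotC v u) !dot_norm => h.
have : 0 <= `|v| ^+ 2 * (`|u| ^+ 2 * `|v| ^+ 2 - dot u v ^+ 2) by lra.
by rewrite pmulr_rge0 ?exprn_gt0// subr_ge0.
Qed.

Lemma dot_cvgl {T : Type} {F : set_system T} {FF : Filter F} (f : T -> H) v u :
  f @ F --> v -> (fun t => dot (f t) u) @ F --> dot v u.
Proof.
move=> fv; apply/cvgrPdist_lt => e e0.
have h : 0 < e / (1 + `|u|) by rewrite divr_gt0 // ltr_wpDr.
have /cvgrPdist_lt /(_ _ h) := fv.
apply: filterS => t /=.
rewrite ltr_pdivlMr ?ltr_wpDr// => ht.
rewrite -dotNl -dotDl (le_lt_trans (cauchy_schwarz _ _))//.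
apply: le_lt_trans ht; rewrite ler_wpM2l //; lra.
Qed.

(** * Convexity, nested intersections and projections *)

Lemma segmentE u v (t : R) : v + t *: (u - v) = t *: u + (1 - t) *: v.
Proof. by rewrite scalerBl scale1r scalerBr addrCA. Qed.

Lemma convex_setP D : convex_set D <->
  forall u v (t : R), D u -> D v -> 0 <= t <= 1 -> D (v + t *: (u - v)).
Proof.
split=> [cD u v t Du Dv /andP[t0 t1]|cD u v t].
  have t01 : Itv.spec (@Itv.num_sem R) (Itv.Real `[0%Z, 1%Z]) t.
    by rewrite /= /Itv.num_sem/= num_real in_itv/= t0 t1.
  by have := cD u v (Itv.mk t01); rewrite !inE => /(_ Du Dv); rewrite segmentE.
rewrite !inE => Du Dv.
have := cD u v t%:num Du Dv; rewrite segmentE; apply.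
by rewrite ge0 le1.
Qed.

Lemma closed_sublevel (f : H -> R) (a : R) :
  continuous f -> closed [set z | f z <= a].
Proof.
move=> fc; apply: (@preimage_closed _ _ f [set r | r <= a]) (@closed_le _ a).
by move=> z _; exact: fc.
Qed.

(** The midpoint is written in the segment form that [convex_setP] provides. *)
Lemma parallelogram u v :
  `|u - v| ^+ 2 = 2 * `|u| ^+ 2 + 2 * `|v| ^+ 2
                  - 4 * `|v + 2^-1 *: (u - v)| ^+ 2.
Proof. rewrite -!dot_norm !dotE (dotC v u); lra. Qed.

Lemma cauchy_seq_cvg (v : nat -> H) :
  (forall e : R, 0 < e -> exists N, forall n, (N <= n)%N -> `|v N - v n| < e) ->
  cvgn v.
Proof.
move=> vC; apply: cauchy_cvg; apply: cauchy_exP => e /= /vC[N vN].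
by exists (v N); exists N => // n /= Nn; rewrite -ball_normE /=; exact: vN.
Qed.

(** Almost minimal-norm points of the [K n] form a Cauchy sequence: midpoints stay in the larger
    set, and the infima of squared norms increase to a finite limit. This yields both projections
    and candidates for weak limits. *)
Lemma nested_convex_nonempty (K : nat -> set H) (M : R) :
  (forall n, closed (K n)) -> (forall n, convex_set (K n)) ->
  (forall n, K n !=set0) -> (forall n, K n.+1 `<=` K n) ->
  (forall v, K 0%N v -> `|v| <= M) ->
  exists w, forall n, K n w.
Proof.
move=> Kcl Kcv Kn0 Kdecr KM.
have Kmono m n : (n <= m)%N -> K m `<=` K n.
  elim: m => [|m IH]; first by rewrite leqn0 => /eqP ->.
  rewrite leq_eqVlt => /predU1P[->//|]; rewrite ltnS => nm.
  exact: subset_trans (Kdecr m) (IH nm).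
pose S n := [set `|v| ^+ 2 | v in K n].
have SI n : has_inf (S n).
  split; first by have [v Kv] := Kn0 n; exists (`|v| ^+ 2), v.
  by exists 0 => _ [v _ <-]; rewrite exprn_ge0.
have Slb n v : K n v -> inf (S n) <= `|v| ^+ 2.
  by move=> Kv; apply: ge_inf; [have [] := SI n|exists v].
have inf_mono : nondecreasing_seq (fun n => inf (S n)).
  apply/nondecreasing_seqP => n; apply: lb_le_inf; first by have [] := SI n.+1.
  by move=> _ [v Kv <-]; apply: Slb; exact: Kdecr.
have inf_cvg : cvgn (fun n => inf (S n)).
  apply: nondecreasing_is_cvgn => //; exists (M ^+ 2) => _ [n _ <-].
  have [v Kv] := Kn0 n; apply: (le_trans (Slb _ _ Kv)).
  by rewrite lerXn2r ?nnegrE// ?KM ?(le_trans _ (KM v _))//; apply: Kmono Kv.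
have /choice[v vP] n : exists v, K n v /\ `|v| ^+ 2 < inf (S n) + n.+1%:R^-1.
  have n0 : 0 < n.+1%:R^-1 :> R by rewrite invr_gt0 ltr0n.
  by have [_ [v Kv <-] vlt] := inf_adherent n0 (SI n); exists v.
have vcvg : cvgn v.
  apply: cauchy_seq_cvg => e e0.
  (* The parallelogram law bounds the squared distance by twice the sum of three quantities: the gap
     from [inf (S N)] to its limit and the two errors 1/(N+1), 1/(m+1). *)
  have d0 : 0 < e ^+ 2 / 6 by rewrite divr_gt0 ?exprn_gt0.
  have [N _ NP] : \forall n \near \oo,
      limn (fun n => inf (S n)) - inf (S n) < e ^+ 2 / 6 /\
      n.+1%:R^-1 < e ^+ 2 / 6.
    near=> n; split.
      apply: le_lt_trans (ler_norm _) _; near: n.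
      exact: (cvgr_dist_lt _ _ inf_cvg).
    by near: n; exact: (near_infty_natSinv_lt (PosNum d0)).
  exists N => m Nm.
  rewrite -(@ltr_pXn2r _ 2) ?nnegrE ?(ltW e0)// parallelogram.
  have [vN vNlt] := vP N; have [vm vmlt] := vP m.
  have [/= lN iN] := NP N (leqnn N); have [/= _ im] := NP m Nm.
  have half01 : 0 <= (2^-1 : R) <= 1 by lra.
  have := Slb N _ ((convex_setP _).1 (Kcv N) _ _ _ vN (Kmono _ _ Nm _ vm) half01).
  have := nondecreasing_cvgn_le inf_mono inf_cvg m.
  move: vNlt vmlt lN iN im; set l := limn _; set iSN := inf (S N).
  set iSm := inf (S m); set a := `|_| ^+ 2; set b := `|_| ^+ 2.
  set c := `|_| ^+ 2; set q := N.+1%:R^-1; set q' := m.+1%:R^-1; lra.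
exists (limn v) => n; apply: (closed_cvg (K n) (Kcl n) _ _ vcvg).
by exists n => // m /= nm; apply: Kmono nm _ (vP m).1.
Unshelve. all: by end_near. Qed.

Lemma exists_proj D x : D !=set0 -> closed D -> convex_set D ->
  exists p, is_proj D x p.
Proof.
move=> D0 Dcl Dcv.
pose S := [set `|x - z| | z in D].
have SI : has_inf S.
  split; first by have [v Kv] := D0; exists (`|x - v|), v.
  by exists 0 => _ [v _ <-].
(* Near-minimizers of the distance: a common point attains the infimum. The slack at index 0 is 1,
   whence the norm bound below. *)
pose K n := D `&` [set z | `|x - z| <= inf S + n.+1%:R^-1].
have [n|n|n|n z [Dz /= zlt]|z [Dz /= zlt]|p pK] :=
    @nested_convex_nonempty K (inf S + 1 + `|x|).
- apply: closedI => //.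
  apply: closed_sublevel => z.
  apply: (@continuous_comp _ _ _ (fun z => x - z) (fun z => `|z|)).
    by apply: cvgB; [exact: cvg_cst|exact: cvg_id].
  exact: norm_continuous.
- apply/convex_setP => u v t [Du /= hu] [Dv /= hv] /andP[t0 t1]; split.
    by apply: ((convex_setP _).1 Dcv) => //; rewrite t0.
  rewrite /=.
  have -> : x - (v + t *: (u - v)) = t *: (x - u) + (1 - t) *: (x - v).
    by rewrite -segmentE opprD addrA -scalerN !opprB [x - u + _]addrC subrKA.
  rewrite (le_trans (ler_normD _ _))// !normrZ !ger0_norm ?subr_ge0//.
  have t1' : 0 <= 1 - t by rewrite subr_ge0.
  have := ler_wpM2l t0 hu; have := ler_wpM2l t1' hv.
  set b := inf S + _; lra.
- have n0 : 0 < n.+1%:R^-1 :> R by rewrite invr_gt0 ltr0n.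
  by have [_ [v Dv <-] /ltW vlt] := inf_adherent n0 SI; exists v.
- split=> //=; apply: le_trans zlt _.
  by rewrite lerD2l lef_pV2 ?posrE// ler_nat.
- rewrite -[z](subrK x) (le_trans (ler_normD _ _))// lerD2r distrC.
  by rewrite invr1 in zlt.
exists p; split; first by have [] := pK 0%N.
move=> y Dy; apply: (@le_trans _ _ (inf S)); last first.
  by apply: ge_inf; [have [] := SI|exists y].
apply/ler_addgt0Pr => e e0.
have [N _ /(_ N (leqnn N)) /= hN] := near_infty_natSinv_lt (PosNum e0).
by have [_ /= /le_trans] := pK N; apply; rewrite lerD2l ltW.
Qed.

Lemma proj_onP D x : D !=set0 -> closed D -> convex_set D ->
  is_proj D x (proj_on D x).
Proof. by move=> D0 Dcl Dcv; apply: xgetPex; exact: exists_proj. Qed.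

Lemma proj_dot_le0 D x p : convex_set D -> is_proj D x p ->
  forall z, D z -> dot (z - p) (x - p) <= 0.
Proof.
move=> Dcv [Dp pmin] z Dz; rewrite leNgt; apply/negP.
set c := dot _ _ => c0; pose q := `|z - p| ^+ 2.
have q0 : 0 <= q by rewrite exprn_ge0.
have qc0 : 0 < q + c by rewrite ltr_wpDl.
(* Minimality along the segment forces 2c <= t q, whereas this [t] in ]0,1] gives t q < c. *)
pose t := c / (q + c).
have t01 : 0 <= t <= 1.
  by rewrite /t divr_ge0 ?(ltW c0) ?(ltW qc0)//= ler_pdivrMr// mul1r lerDr.
have t0 : 0 < t by rewrite divr_gt0.
have := pmin _ ((convex_setP D).1 Dcv _ _ _ Dz Dp t01).
rewrite -(@ler_pXn2r _ 2) ?nnegrE// opprD addrA (normB_sqr (x - p)).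
rewrite dotZr (dotC (x - p)) -/c normrZ exprMn ger0_norm ?(ltW t0)// -/q => le_t.
have : t * (2 * c) <= t * (t * q) by lra.
rewrite ler_pM2l// /t mulrAC ler_pdivlMr//.
have : 0 < c * c by rewrite mulr_gt0.
have : 0 <= c * q by rewrite mulr_ge0// ltW.
nra.
Qed.

(** Expanding |(x - p) - (z - p)|^2, the obtuse angle at [p] leaves |z - p|^2 <= 0. *)
Lemma is_proj_unique D x p z : convex_set D -> is_proj D x p -> D z ->
  `|x - z| <= `|x - p| -> z = p.
Proof.
move=> Dcv pP Dz; have le0 := proj_dot_le0 Dcv pP Dz.
rewrite -(@ler_pXn2r _ 2) ?nnegrE//.
have -> : x - z = (x - p) - (z - p) by rewrite opprB addrA subrK.
rewrite (normB_sqr (x - p)) (dotC (x - p)) => le2.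
apply/eqP; rewrite -subr_eq0 -normr_eq0 -sqrf_eq0 eq_le sqr_ge0 andbT; lra.
Qed.

(** * Extraction of subsequences and weak sequential compactness *)

Lemma strictly_increasing_choice (P : nat -> nat -> Prop) :
  (forall k N, exists n, (N < n)%N /\ P k n) ->
  exists phi : nat -> nat, {homo phi : m n / (m < n)%N} /\ forall k, P k (phi k).
Proof.
move=> PN; have /choice[g gP] (kN : nat * nat) :
    exists n, (kN.2 < n)%N /\ P kN.1 n by exact: PN.
pose phi := fix phi k := if k is k'.+1 then g (k, phi k') else g (0, 0)%N.
exists phi; split; last by case=> [|k]; exact: (gP (_, _)).2.
by apply: homo_ltn => [|k]; [exact: ltn_trans|exact: (gP (_, _)).1].
Qed.

(* Using one ultrafilter for all sequences replaces a diagonal extraction. *)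
Lemma ultra_bounded_cvg (U : set_system nat) (f : nat -> R) (B : R) :
  UltraFilter U -> (forall n, `|f n| <= B) ->
  exists c, forall e, 0 < e -> U [set n | `|c - f n| < e].
Proof.
move=> UU fB.
have [|c [_ cP]] := @segment_compact R (- B) B (f @ U) _.
  change (U (f @^-1` `[- B, B]%classic)); apply: filterE => n /=.
  by rewrite in_itv/= -ler_norml.
exists c => e e0.
have [//|UN] := in_ultra_setVsetC [set n | `|c - f n| < e] UU.
have fUN : U (f @^-1` (f @` (~` [set n | `|c - f n| < e]))).
  by apply: filterS UN => n nP; exists n.
have [_ [[n nP <-] /=]] := cP _ _ fUN (nbhsx_ballx _ _ e0).
by rewrite -ball_normE /=.
Qed.

(** Take [c m] to be the limit along an ultrafilter finer than [\oo]. The conditions for m <= k are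
    finitely many, so they hold together on a set of the ultrafilter, which meets every tail. *)
Lemma gram_subsequence (y : nat -> H) (M : R) : (forall n, `|y n| <= M) ->
  exists (phi : nat -> nat) (c : nat -> R), {homo phi : m n / (m < n)%N} /\
    forall m, (fun k => dot (y (phi k)) (y m)) @ \oo --> c m.
Proof.
move=> yM.
have [U [UU ooU]] := @ultraFilterLemma _ \oo _.
have M0 : 0 <= M by exact: le_trans (yM 0%N).
have /choice[c cP] m : exists c, forall e : R, 0 < e ->
    U [set n | `|c - dot (y n) (y m)| < e].
  apply: (@ultra_bounded_cvg _ _ (M * M) UU) => n.
  by rewrite (le_trans (cauchy_schwarz _ _))// ler_pM.
have [k N|phi [phi_incr phiP]] := @strictly_increasing_choice (fun k n =>
    forall m : 'I_k.+1, `|c m - dot (y n) (y m)| < k.+1%:R^-1).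
  have Uk : U [set n | forall m : 'I_k.+1, `|c m - dot (y n) (y m)| < k.+1%:R^-1].
    by apply: filter_forall => m; apply: cP; rewrite invr_gt0 ltr0n.
  have UN : U [set n | (N < n)%N] by apply: ooU; exact: nbhs_infty_gt.
  by have [n [nP Nn]] := filter_ex (filterI Uk UN); exists n.
exists phi, c; split=> // m; apply/cvgrPdist_lt => e e0; near=> k.
have mk : (m < k.+1)%N by rewrite ltnS; near: k; exact: nbhs_infty_ge.
apply: lt_trans (phiP k (Ordinal mk)) _; near: k.
exact: (near_infty_natSinv_lt (PosNum e0)).
Unshelve. all: by end_near. Qed.

(** The variational inequality is tested at p + g and p - g. *)
Lemma proj_subspace_ortho (G : set H) u p :
  G 0 -> (forall v w, G v -> G w -> G (v + w)) ->
  (forall (a : R) v, G v -> G (a *: v)) ->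
  is_proj G u p -> forall g, G g -> dot g (u - p) = 0.
Proof.
move=> G0 GD GZ pP g Gg; have [Gp _] := pP.
have Gcv : convex_set G.
  by apply/convex_setP => v w t Gv Gw _; rewrite -[v - w]addrC -scaleN1r; auto.
have := proj_dot_le0 Gcv pP (GD _ _ Gg Gp).
have := proj_dot_le0 Gcv pP (GD _ _ (GZ (-1) _ Gg) Gp).
rewrite !addrK dotZl => h1 h2; lra.
Qed.

Lemma closed_halfspace_closed (u : H) (a : R) : closed [set v | dot v u <= a].
Proof. by apply: closed_sublevel => v; apply: dot_cvgl; exact: cvg_id. Qed.

Lemma closed_halfspace_convex (u : H) (a : R) :
  convex_set [set v | dot v u <= a].
Proof.
apply/convex_setP => v w t /= hv hw /andP[t0 t1].
have t1' : 0 <= 1 - t by rewrite subr_ge0.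
rewrite segmentE dotDl !dotZl.
by have := ler_wpM2l t0 hv; have := ler_wpM2l t1' hw; lra.
Qed.

Lemma convex_setI D E : convex_set D -> convex_set E -> convex_set (D `&` E).
Proof.
move=> /convex_setP cD /convex_setP cE.
apply/convex_setP => u v t [Du Eu] [Dv Ev] t01.
by split; [exact: cD|exact: cE].
Qed.

(* The closed convex hull of the tail, as an intersection of half-spaces. *)
Definition tail_hull (z : nat -> H) (n : nat) : set H :=
  [set v | forall u a, (forall k, (n <= k)%N -> dot (z k) u <= a) ->
           dot v u <= a].

(** For every e > 0 some tail lies in the slab |<.|u> - l| <= e, hence so does [w]. *)
Lemma tail_hull_cvg (z : nat -> H) w u (l : R) : (forall n, tail_hull z n w) ->
  (fun k => dot (z k) u) @ \oo --> l -> dot w u = l.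
Proof.
move=> wz zl; apply/eqP; rewrite eq_le; apply/andP; split.
  apply/ler_addgt0Pr => e e0; have [N _ NP] := cvgr_dist_lt _ _ zl _ e0.
  apply: (wz N) => k /NP /=; rewrite distrC ltr_norml => /andP[]; lra.
rewrite -lerN2 -dotNr; apply/ler_addgt0Pr => e e0.
have [N _ NP] := cvgr_dist_lt _ _ zl _ e0.
by apply: (wz N) => k /NP /=; rewrite dotNr ltr_norml => /andP[]; lra.
Qed.

Lemma tail_hull_nonempty (z : nat -> H) (M : R) : (forall n, `|z n| <= M) ->
  exists w, forall n, tail_hull z n w.
Proof.
move=> zM; have M0 : 0 <= M by exact: le_trans (zM 0%N).
have hullE n : tail_hull z n =
    \bigcap_(q in [set q : H * R | forall k, (n <= k)%N -> dot (z k) q.1 <= q.2])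
      [set v | dot v q.1 <= q.2].
  by apply/seteqP; split => [v vz [u a] /= /vz|v vz u a ua]; last exact: (vz (u, a)).
apply: (@nested_convex_nonempty _ M) => [n|n|n|n v vz u a ua|v vz].
- rewrite hullE; apply: closed_bigI => q _; exact: closed_halfspace_closed.
- apply/convex_setP => v w t vz wz t01 u a ua.
  by apply: ((convex_setP _).1 (@closed_halfspace_convex u a)) => //=; auto.
- by exists (z n) => u a; apply.
- by apply: vz => k /ltnW; exact: ua.
(* Testing the hull in the direction [v] itself gives |v|^2 <= M |v|. *)
- have [->|v0] := eqVneq v 0; first by rewrite normr0.
  have nv : 0 < `|v| by rewrite normr_gt0.
  rewrite -(ler_pM2r nv) -expr2 -dot_norm; apply: vz => k _.
  rewrite (le_trans (ler_norm _))// (le_trans (cauchy_schwarz _ _))//.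
  by rewrite ler_wpM2r.
Qed.

Lemma bounded_weak_subseq (y : nat -> H) (M : R) : (forall n, `|y n| <= M) ->
  exists w, weak_seq_cluster_point dot y w.
Proof.
move=> yM; have [phi [c [phi_incr cP]]] := gram_subsequence yM.
pose z := y \o phi; have zM n : `|z n| <= M by exact: yM.
have M0 : 0 <= M by exact: le_trans (zM 0%N).
have [w wz] := tail_hull_nonempty zM.
exists w, phi; split=> //.
pose G := [set u | (fun k => dot (z k) u) @ \oo --> dot w u].
have Gz m : G (z m) by rewrite /G /= (tail_hull_cvg wz (cP (phi m))); exact: cP.
have G0 : G 0.
  rewrite /G /= linear0r; under eq_fun do rewrite linear0r; exact: cvg_cst.
have GD u v : G u -> G v -> G (u + v).
  move=> Gu Gv; rewrite /G /= dotDr; under eq_fun do rewrite dotDr.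
  exact: cvgD.
have GZ (a : R) u : G u -> G (a *: u).
  move=> Gu; rewrite /G /= dotZr; under eq_fun do rewrite dotZr.
  exact: cvgMl_tmp.
have Gcl : closed G.
  move=> u uG; apply/cvgrPdist_lt => e e0.
  (* [B] dominates |w - z k| uniformly in k; the added 1 makes it positive. *)
  pose B := M + `|w| + 1; have B0 : 0 < B by rewrite ltr_wpDl// addr_ge0.
  have eB : 0 < e / 2 / B by rewrite !divr_gt0.
  have [v [Gv]] := uG _ (nbhsx_ballx u _ eB).
  rewrite -ball_normE /= ltr_pdivlMr// => uv.
  have e20 : 0 < e / 2 by rewrite divr_gt0.
  move/cvgrPdist_lt: Gv => /(_ _ e20); apply: filterS => k.
  move=> /= kv.
  have -> : dot w u - dot (z k) u =
      dot (w - z k) (u - v) + (dot w v - dot (z k) v) by rewrite !dotE; ring.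
  rewrite (le_lt_trans (ler_normD _ _))// [e]splitr ltrD//.
  apply: le_lt_trans uv; rewrite (le_trans (cauchy_schwarz _ _))// mulrC.
  rewrite ler_wpM2l// (le_trans (ler_normB _ _))//.
  by have := zM k; rewrite /B; lra.
have Gcv : convex_set G.
  by apply/convex_setP => v u t Gv Gu _; rewrite -[v - u]addrC -scaleN1r; auto.
(* Replacing [u] by its projection on [G] changes neither <z k|u> nor <w|u>, so convergence at [p]
   suffices. *)
move=> u; have [p pP] := exists_proj u (ex_intro _ 0 G0) Gcl Gcv.
have ortho := proj_subspace_ortho G0 GD GZ pP.
have [Gp _] := pP.
have zp k : dot (z k) u = dot (z k) p.
  by apply/eqP; rewrite -subr_eq0 -dotNr -dotDr ortho.
have wup : dot w (u - p) = 0.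
  apply: (tail_hull_cvg wz); under eq_fun do rewrite ortho//; exact: cvg_cst.
have -> : dot w u = dot w p by apply/eqP; rewrite -subr_eq0 -dotNr -dotDr wup.
by under eq_fun do rewrite zp.
Qed.

(** * Geometry of the half-spaces [Hset] *)

Lemma Hset_xx x : Hset dot x x = setT.
Proof. by apply/seteqP; split=> // z _; rewrite /Hset /= subrr linear0r. Qed.

Lemma HsetE x y : Hset dot x y = [set z | dot z (x - y) <= dot y (x - y)].
Proof.
by apply/seteqP; split=> z; rewrite /Hset /= dotDl dotNl subr_le0.
Qed.

Lemma Hset_closed x y : closed (Hset dot x y).
Proof. by rewrite HsetE; exact: closed_halfspace_closed. Qed.

Lemma Hset_convex x y : convex_set (Hset dot x y).
Proof. by rewrite HsetE; exact: closed_halfspace_convex. Qed.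

(** The angle at [y] is obtuse, so the cross term in |(z - y) - (x - y)|^2 has a favourable sign. *)
Lemma Hset_pythagoras x y z : Hset dot x y z ->
  `|z - y| ^+ 2 <= `|z - x| ^+ 2 - `|y - x| ^+ 2.
Proof.
rewrite /Hset /=.
have -> : z - x = (z - y) - (x - y) by rewrite opprB addrA subrK.
by rewrite (normB_sqr (z - y)) (distrC y); lra.
Qed.

(** With r the relaxed point, x - r = t (x - p) and z - r = (z - p) - (1 - t)(x - p); their product
    is nonpositive as t <= 1. *)
Lemma sub_Hset_relaxed_proj D x p (t : R) : convex_set D -> is_proj D x p ->
  0 < t <= 1 -> D `<=` Hset dot x (x + t *: (p - x)).
Proof.
move=> Dcv pP /andP[t0 t1] z /(proj_dot_le0 Dcv pP) le0; rewrite /Hset /=.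
have -> : x - (x + t *: (p - x)) = t *: (x - p).
  by rewrite opprD addNKr -scalerN opprB.
have -> : z - (x + t *: (p - x)) = (z - p) - (1 - t) *: (x - p).
  rewrite -(opprB p x) scalerN opprK scalerBl scale1r addrA subrKA opprD.
  by rewrite addrA.
rewrite dotZr dotDl dotNl dotZl dot_norm pmulr_rle0// subr_le0.
by rewrite (le_trans le0)// mulr_ge0 ?subr_ge0// exprn_ge0.
Qed.

Lemma series_lt_pinfty (f : nat -> R) (B : R) : (forall n, 0 <= f n) ->
  (forall n, \sum_(0 <= k < n) f k <= B) ->
  (\sum_(0 <= n <oo) (f n)%:E < +oo)%E.
Proof.
move=> f0 fB; apply: (@le_lt_trans _ _ B%:E); last exact: ltry.
apply: lime_le; first by apply: is_cvg_nneseries => n _ _; rewrite lee_fin.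
by apply: nearW => n; rewrite sumEFin lee_fin.
Qed.

End Hilbert.

(** * Haugazeau-type iteration: estimates and strong convergence *)

Theorem theorem4p7 (R : realType) (H : completeNormedModType R)
    (dot : {dot H for idfun}) (dot_norm : norm_from_dot dot)
    (Z : set H) (Z_nonempty : Z !=set0) (Z_closed : closed Z)
    (Z_convex : convex_set Z)
    (lambda : nat -> R) (lambda01 : forall n, 0 < lambda n <= 1)
    (x0 : H) (Hn : nat -> set H) (x p r : nat -> H)
    (Hn_halfspace : forall n, closed_halfspace dot (Hn n))
    (Z_sub_Hn : forall n, Z `<=` Hn n)
    (x_init : x 0%N = x0)
    (p_def : forall n, p n = proj_on (Hn n) (x n))
    (r_def : forall n, r n = x n + lambda n *: (p n - x n))
    (x_step : forall n, x n.+1 = Qproj dot x0 (x n) (r n)) :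
  (forall n, Hset dot x0 (x n) `&` Hset dot (x n) (r n) !=set0) /\
  (forall n, Z `<=` Hset dot x0 (x n) `&` Hset dot (x n) (r n)) /\
  (exists l : R,
     [/\ 0 <= l,
         nondecreasing_seq (fun n => `|x n - x0|),
         (fun n => `|x n - x0|) @ \oo --> l
       & l <= dist_to Z x0]) /\
  (\sum_(0 <= n <oo) (`|x n.+1 - x n| ^+ 2)%:E < +oo)%E /\
  (\sum_(0 <= n <oo) (lambda n ^+ 2 * `|p n - x n| ^+ 2)%:E < +oo)%E /\
  ((forall w : H, weak_seq_cluster_point dot x w -> Z w) ->
     x @ \oo --> proj_on Z x0).
Proof.
have Zr n : Z `<=` Hset dot (x n) (r n).
  have [u [eta [_ HnE]]] := Hn_halfspace n.
  have Hn_convex : convex_set (Hn n).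
    by rewrite HnE; exact: closed_halfspace_convex.
  rewrite r_def; apply: subset_trans (Z_sub_Hn n) _.
  apply: sub_Hset_relaxed_proj => //; rewrite p_def; apply: proj_onP => //.
    by have [z Zz] := Z_nonempty; exists z; exact: Z_sub_Hn.
  by rewrite HnE; exact: closed_halfspace_closed.
pose C n := Hset dot x0 (x n) `&` Hset dot (x n) (r n).
have C_convex n : convex_set (C n) by apply: convex_setI; exact: Hset_convex.
(* Nonemptiness of [C n] rules out the default value of [proj_on]; it is available only once the
   induction below reaches n. *)
have x_proj n : Z `<=` C n -> is_proj (C n) x0 (x n.+1).
  move=> ZC; rewrite x_step; apply: proj_onP => //.
    by have [z Zz] := Z_nonempty; exists z; exact: ZC.
  by apply: closedI; exact: Hset_closed.
have ZC n : Z `<=` C n.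
  elim: n => [|n IHn] z Zz; split; try exact: Zr.
    by rewrite x_init Hset_xx.
  (* The variational inequality at [x n.+1], the projection of [x0] onto [C n], is exactly
     membership in H(x0, x_(n+1)). *)
  by apply: (proj_dot_le0 dot_norm (C_convex n) (x_proj n IHn)); exact: IHn.
have step n : C n (x n.+1) by have [] := x_proj n (ZC n).
have step_sqr n : `|x n.+1 - x n| ^+ 2 <= `|x n.+1 - x0| ^+ 2 - `|x n - x0| ^+ 2.
  by apply: (Hset_pythagoras dot_norm); have [] := step n.
have p_sqr n : lambda n ^+ 2 * `|p n - x n| ^+ 2 <= `|x n.+1 - x n| ^+ 2.
  have [_ /(Hset_pythagoras dot_norm)] := step n.
  have -> : r n - x n = lambda n *: (p n - x n) by rewrite r_def addrC addKr.
  rewrite normrZ exprMn real_normK ?num_real//.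
  by have := sqr_ge0 `|x n.+1 - r n|; lra.
have dist_le n z : Z z -> `|x n - x0| <= `|x0 - z|.
  move=> /(ZC n)[/(Hset_pythagoras dot_norm) zn _].
  rewrite -(@ler_pXn2r _ 2) ?nnegrE// (distrC x0).
  by have := sqr_ge0 `|z - x n|; lra.
have dist_nd : nondecreasing_seq (fun n => `|x n - x0|).
  apply/nondecreasing_seqP => n; rewrite -(@ler_pXn2r _ 2) ?nnegrE//.
  by have := step_sqr n; have := sqr_ge0 `|x n.+1 - x n|; lra.
have [z Zz] := Z_nonempty.
have sum_le n : \sum_(0 <= k < n) `|x k.+1 - x k| ^+ 2 <= `|x0 - z| ^+ 2.
  apply: (@le_trans _ _ (`|x n - x0| ^+ 2)); last first.
    by rewrite lerXn2r ?nnegrE// dist_le.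
  elim: n => [|n IHn]; first by rewrite big_geq// exprn_ge0.
  by rewrite big_nat_recr//=; have := step_sqr n; lra.
split; first by move=> n; exists z; exact: ZC.
split=> //; split.
  have dist_cvg : cvgn (fun n => `|x n - x0|).
    apply: nondecreasing_is_cvgn => //; exists `|x0 - z| => _ [n _ <-].
    exact: dist_le.
  exists (limn (fun n => `|x n - x0|)); split=> //.
    by apply: limr_ge => //; exact: nearW.
  apply: lb_le_inf; first by exists `|x0 - z|, z.
  move=> _ [z' Zz' <-]; apply: limr_le => //; apply: nearW => n.
  exact: dist_le.
split.
  apply: (series_lt_pinfty (B := `|x0 - z| ^+ 2)) => n.
    exact: exprn_ge0.
  exact: sum_le.
split.
  apply: (series_lt_pinfty (B := `|x0 - z| ^+ 2)) => n.
    by rewrite mulr_ge0 ?exprn_ge0// ltW//; case/andP: (lambda01 n).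
  by apply: le_trans (sum_le n); apply: ler_sum => k _; exact: p_sqr.
move=> clusterZ; set q := proj_on Z x0.
have qP : is_proj Z x0 q by exact: proj_onP.
have [Zq _] := qP.
have dist_weak (phi : nat -> nat) w : weak_cvg dot (x \o phi) w ->
    `|x0 - w| <= `|x0 - q|.
  move=> xw.
  have [->|w0] := eqVneq w x0; first by rewrite subrr normr0.
  have nw : 0 < `|w - x0| by rewrite normr_gt0 subr_eq0.
  (* Weak lower semicontinuity of the norm: |w - x0|^2 is the limit of <x_(phi k) - x0|w - x0>,
     bounded by Cauchy-Schwarz. *)
  rewrite distrC -(ler_pM2r nw) -expr2 -(dot_norm (w - x0)) dotDl dotNl.
  rewrite lerBlDl; apply: (closed_cvg _ (@closed_le _ _) _ _ (xw (w - x0))).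
  apply: nearW => k /=; rewrite -lerBlDl -dotNl -dotDl.
  rewrite (le_trans (ler_norm _))// (le_trans (cauchy_schwarz dot_norm _ _))//.
  by rewrite ler_wpM2r// dist_le.
apply: contrapT => xNq.
have [e [e0 eP]] : exists e : R, 0 < e /\
    forall N, exists n, (N < n)%N /\ e <= `|q - x n|.
  apply: contrapT => noe; apply: xNq; apply/cvgrPdist_lt => e e0.
  apply: contrapT => far; apply: noe; exists e; split=> // N.
  apply: contrapT => noN; apply: far; exists N.+1 => // n /= Nn.
  by rewrite ltNge; apply/negP => en; apply: noN; exists n.
have [psi [psi_incr psiP]] := strictly_increasing_choice (fun _ : nat => eP).
have xM n : `|(x \o psi) n| <= `|x0 - q| + `|x0|.
  rewrite -[(x \o psi) n](subrK x0) (le_trans (ler_normD _ _))// lerD2r.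
  exact: dist_le.
have [w [phi [phi_incr xw]]] := bounded_weak_subseq dot_norm xM.
have wq : w = q.
  apply: (is_proj_unique dot_norm Z_convex qP) (dist_weak (psi \o phi) _ xw).
  by apply: clusterZ; exists (psi \o phi); split=> // m n /phi_incr/psi_incr.
(* Half of e^2 because |v - q|^2 <= 2 <q - v|q - x0>, while |v - q| >= e along the subsequence. *)
have e20 : 0 < e ^+ 2 / 2 by rewrite divr_gt0 ?exprn_gt0.
have [k _ /(_ k (leqnn k)) /=] := cvgr_dist_lt _ _ (xw (q - x0)) _ e20.
rewrite wq => /(le_lt_trans (ler_norm _)).
have := dist_le (psi (phi k)) _ Zq; have := psiP (phi k).
set v := x _; rewrite distrC (distrC x0).
have -> : v - q = (v - x0) - (q - x0) by rewrite opprB addrA subrK.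
rewrite -(@ler_pXn2r _ 2) ?nnegrE ?(ltW e0)// (normB_sqr dot_norm (v - x0)).
move=> far; rewrite -(@ler_pXn2r _ 2) ?nnegrE// => le_dist.
have := dot_norm (q - x0); move: far le_dist.
rewrite (dotDl dot v) (dotDl dot q (- x0) (q - x0)) (dotNl dot x0).
set a := dot v _; set b := dot q _; set c := dot x0 _; lra.
Qed.
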